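(* For every integer $n\ge 1$, \[ |\mathfrak D^1_{2n}(2341,1423)|=\frac{1}{\sqrt{17}}\left(\left(\frac{3+\sqrt{17}}{2}\right)^n-\left(\frac{3-\sqrt{17}}{2}\right)^n\right)=\left[\frac{1}{\sqrt{17}}\left(\frac{3+\sqrt{17}}{2}\right)^n\right], \] where $[a]$ denotes the integer closest to $a$.
   Context: A Dumont permutation of the first kind of length $2n$ is a permutation $\pi\in\mathfrak S_{2n}$ such that for every $i=1,\dots,2n$: if $\pi(i)$ is even then $i<2n$ and $\pi(i)>\pi(i+1)$; if $\pi(i)$ is odd then $i=2n$ or $\pi(i)<\pi(i+1)$. $\mathfrak D^1_{2n}$ denotes the set of these. A permutation $\sigma$ contains a pattern $\tau\in\mathfrak S_k$ if some subsequence $(\sigma(i_1),\dots,\sigma(i_k))$, $i_1<\dots<i_k$, is order-isomorphic to $\tau$; otherwise $\sigma$ avoids $\tau$. $\mathfrak D^1_{2n}(T)$ denotes the set of permutations in $\mathfrak D^1_{2n}$ avoiding every pattern in $T$. *)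

(* Defs.v *)
From HB Require Import structures.
From mathcomp Require Import all_boot all_order all_algebra all_fingroup.
From mathcomp Require Import reals.
Set Implicit Arguments. Unset Strict Implicit. Unset Printing Implicit Defensive.
Import Order.TTheory GRing.Theory Num.Theory.

(* One-line notation of a permutation of 'I_m as a word over {1,..,m}:
   the i-th letter (0-based) is pi(i+1) in the paper's 1-based convention. *)
Definition perm_word (m : nat) (s : 'S_m) : seq nat :=
  [seq (val (s i)).+1 | i <- enum 'I_m].

Definition dumont1_word (w : seq nat) : bool :=
  all (fun i =>
         if ~~ odd (nth 0 w i)
         then (i.+1 < size w) && (nth 0 w i.+1 < nth 0 w i)
         else (i.+1 == size w) || (nth 0 w i < nth 0 w i.+1))
      (iota 0 (size w)).

Definition order_iso (s t : seq nat) : bool :=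
  (size s == size t) &&
  all (fun i => all (fun j => (nth 0 s i < nth 0 s j) == (nth 0 t i < nth 0 t j))
                    (iota 0 (size s)))
      (iota 0 (size s)).

(* Subsequences of w are exactly the masks of w (positions i_1<...<i_k). *)
Definition contains_pattern (w p : seq nat) : bool :=
  [exists m : (size w).-tuple bool, order_iso (mask m w) p].

Definition avoids_pattern (w p : seq nat) : bool := ~~ contains_pattern w p.

Definition Dumont1_avoiding (n : nat) (T : seq (seq nat)) : {set 'S_(n.*2)} :=
  [set s : 'S_(n.*2) | dumont1_word (perm_word s) &&
                        all (avoids_pattern (perm_word s)) T].

Definition nearest_int (R : realType) (a : R) : int := Num.floor (a + 2^-1)%R.

(* Main.v *)
(* Let N = 2n >= 4 and look at the letters N-1 and N of a word in the class; N-1 is either followed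
   by N or last.  If w = A (N-1) N B with A nonempty, avoiding 2341 forces A < B and then avoiding
   1423 forces B to be decreasing, so the Dumont condition leaves only B = (N-2)(N-3).  If
   w = A N B (N-1) with A and B nonempty, avoiding 1423 forces A > B and avoiding 2341 forces A to
   be decreasing, hence A = (N-2)(N-3).  So the words in the class are exactly
     (N-1) N w,   N w (N-1),   w N (N-1)            with w in the class for n-1,
     w (N-1) N (N-2)(N-3),   (N-2)(N-3) N w (N-1)   with w nonempty in the class for n-2,
   and the cardinals satisfy a(n) = 3 a(n-1) + 2 a(n-2) with a(0) = 0 and a(1) = 1.  The second
   root of x^2 = 3x + 2 contributes less than 1/2, which gives the nearest-integer form. *)
Require Import Defs.
From HB Require Import structures.
From mathcomp Require Import all_boot all_order all_algebra all_fingroup.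
From mathcomp Require Import reals.
From mathcomp Require Import zify ring lra.
Import Order.TTheory GRing.Theory Num.Theory.
Local Open Scope nat_scope.

(** * Subsequences, the Dumont condition and the two patterns *)

Lemma subseq_cat_split (T : eqType) (s u v : seq T) :
  subseq s (u ++ v) ->
  exists s1 s2, [/\ s = s1 ++ s2, subseq s1 u & subseq s2 v].
Proof.
elim: u s => [|x u IH] s /=; first by exists [::], s.
case: s => [|y s] /=; first by exists [::], [::]; rewrite !sub0seq.
case: eqP => [->|ne] /IH [s1 [s2 [e h1 h2]]].
  by exists (x :: s1), s2; rewrite e /= eqxx.
exists s1, s2; split=> //; case: s1 e h1 => //= z s1 [<- _].
by move/eqP/negPf: ne => ->.
Qed.

Lemma subseq_head2 (T : eqType) (x y : T) (s : seq T) :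
  y \in s -> subseq [:: x; y] (x :: s).
Proof. by move=> ys /=; rewrite eqxx sub1seq. Qed.

Definition dumont_step (x y : nat) : bool := if odd x then x < y else y < x.

Lemma dumont1_word_cons (x : nat) (w : seq nat) :
  dumont1_word (x :: w) =
  (if odd x then (w == [::]) || (x < head 0 w)
   else (w != [::]) && (head 0 w < x)) && dumont1_word w.
Proof.
rewrite /dumont1_word /= -[1]/(0.+1) (iotaDl 1) all_map; congr andb.
  by case: w => [|y w] //=; rewrite ?eqSS; case: (odd x).
Qed.

(** The constraints on neighbouring letters form a chain; what remains is that the final letter,
    having no successor, is odd. The default 1 is odd, so the empty word qualifies. *)
Lemma dumont1_wordE (w : seq nat) :
  dumont1_word w = sorted dumont_step w && odd (last 1 w).
Proof.
elim: w => // x w IH; rewrite dumont1_word_cons IH.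
case: w {IH} => [|y w] /=; first by case: (odd x).
by rewrite /dumont_step; case: (odd x); rewrite andbA.
Qed.

(** The first disjunct is an occurrence of 2341, the second an occurrence of 1423. *)
Definition forbidden (a b c d : nat) : bool :=
  [&& d < a, a < b & b < c] || [&& a < c, c < d & d < b].

Definition dumont_patterns : seq (seq nat) := [:: [:: 2; 3; 4; 1]; [:: 1; 4; 2; 3]].

Lemma contains_patternP (w p : seq nat) :
  reflect (exists2 s, subseq s w & order_iso s p) (contains_pattern w p).
Proof.
apply: (iffP existsP) => [[m hm]|[s /subseqP [m sm ->] hm]].
  by exists (mask m w) => //; apply: mask_subseq.
have sz : size m == size w by apply/eqP.
by exists (Tuple sz).
Qed.

(** Both patterns have length 4, so order isomorphism reduces to linear inequalities between four
    letters, which [lia] can handle. *)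
Lemma avoids_patternsP (w : seq nat) :
  reflect (forall a b c d, subseq [:: a; b; c; d] w -> ~~ forbidden a b c d)
          (all (avoids_pattern w) dumont_patterns).
Proof.
apply: (iffP idP) => [|H].
  rewrite /= andbT => /andP[h1 h2] a b c d sub.
  apply/negP => /orP[] h.
    move: h1; apply/negP/negPn/contains_patternP; exists [:: a; b; c; d] => //.
    rewrite /order_iso /= !ltnn; lia.
  move: h2; apply/negP/negPn/contains_patternP; exists [:: a; b; c; d] => //.
  rewrite /order_iso /= !ltnn; lia.
apply/allP => p; rewrite !inE => hp.
apply/negP => /contains_patternP [s sub iso].
have sz : size s = 4.
  by case/andP: iso => /eqP-> _; case/orP: hp => /eqP->.
case: s sub iso sz => [|a [|b [|c [|d []]]]] //= sub iso _.
move/negP: (H _ _ _ _ sub); apply.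
by case/orP: hp iso => /eqP->; rewrite /order_iso /forbidden /= !ltnn; lia.
Qed.

(** * Words of the class and their extensions by two or four letters *)

Definition dumont_word (k : nat) (w : seq nat) : bool :=
  [&& perm_eq w (iota 1 k), dumont1_word w & all (avoids_pattern w) dumont_patterns].

Lemma iota_add2 (k : nat) : iota 1 k.+2 = iota 1 k ++ [:: k.+1; k.+2].
Proof. by rewrite -[in LHS]addn2 iotaD add1n. Qed.

Lemma mem_perm_iota (k x : nat) (w : seq nat) :
  perm_eq w (iota 1 k) -> (x \in w) = (0 < x <= k).
Proof. by move=> /perm_mem->; rewrite mem_iota add1n ltnS. Qed.

(* Pairs (U, V): the word w of letters at most k is extended to U w V. *)
Definition wraps2 (k : nat) : seq (seq nat * seq nat) :=
  [:: ([:: k.+1; k.+2], [::]); ([:: k.+2], [:: k.+1]); ([::], [:: k.+2; k.+1])].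

Definition wraps4 (k : nat) : seq (seq nat * seq nat) :=
  [:: ([::], [:: k.+3; k.+4; k.+2; k.+1]); ([:: k.+2; k.+1; k.+4], [:: k.+3])].

(** All letters of [U] and [V] are explicit and exceed [k], so an occurrence not contained in [w] is
    refuted by cases on how its four letters are shared among [U], [w] and [V]. *)
Lemma avoids_wrap (k : nat) (U w V : seq nat) :
  all (fun x => x <= k) w -> all (avoids_pattern w) dumont_patterns ->
  (U, V) \in wraps2 k ++ wraps4 k ->
  all (avoids_pattern (U ++ w ++ V)) dumont_patterns.
Proof.
move=> /allP wk /avoids_patternsP av UV; apply/avoids_patternsP => a b c d.
move=> /subseq_cat_split[s1 [s' [e sU /subseq_cat_split[s2 [s3 [e' sw sV]]]]]].
have {wk} : all (fun x => x <= k) s2.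
  by apply/allP => x /(mem_subseq sw) /wk.
rewrite {s'}e' in e.
case: s1 e sU => [|? [|? [|? [|? [|??]]]]] //=;
case: s2 sw => [|? [|? [|? [|? [|??]]]]] //= sw;
case: s3 sV => [|? [|? [|? [|? [|??]]]]] //= sV;
(* When all four letters lie in [w], avoidance by [w] applies. *)
case=> ? ? ? ?; subst; try by move=> *; apply: av.
all: rewrite !inE in UV; move=> sU hk.
all: move: UV sU sV; rewrite !xpair_eqE /= => UV.
all: repeat (case/orP: UV => UV).
all: case/andP: UV => /eqP-> /eqP-> /=.
all: repeat (case: (@eqP nat) => ?; subst => //=).
all: try by move=> /eqP.
all: try by move=> _ /eqP.
all: rewrite /forbidden; move: hk => /=; lia.
Qed.

(** For even [k], a nonempty [U] ends in an even letter, which drops to [w], and [w] ends in an odd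
    letter, which rises to [V]. The word [w] must be nonempty: in (N-1) N w the even letter N needs
    a successor. *)
Lemma dumont_word_wrap (k : nat) (U w V : seq nat) :
  ~~ odd k -> w != [::] -> dumont_word k w -> (U, V) \in wraps2 k ++ wraps4 k ->
  dumont_word (k + size U + size V) (U ++ w ++ V).
Proof.
move=> ek w0 /and3P[pw dw aw] UV.
have wk x : x \in w -> 0 < x <= k by rewrite (mem_perm_iota _ _ _ pw).
apply/and3P; split; last 1 first.
- by apply: avoids_wrap UV => //; apply/allP => x /wk /andP[].
- apply/seq.permP => P; rewrite !count_cat (seq.permP pw).
  rewrite !iotaD !count_cat; move: UV; rewrite !inE !xpair_eqE => UV.
  by do ![case/orP: UV => UV]; case/andP: UV => /eqP-> /eqP-> /=;
    rewrite ?add1n ?addn0 ?addn1 ?addn2 ?addn3; lia.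
case: w w0 pw dw aw wk => // x w _ _.
rewrite !dumont1_wordE /= => /andP[pxw oxw] _ wk.
have xk : 0 < x <= k := wk x (mem_head _ _).
have lk : 0 < last x w <= k := wk _ (mem_last x w).
move: UV; rewrite !inE !xpair_eqE => UV.
by do ![case/orP: UV => UV]; case/andP: UV => /eqP-> /eqP-> /=;
  rewrite ?cat_path ?last_cat /= ?cats0 ?pxw /dumont_step /= ?oxw ?(negPf ek) /=;
  lia.
Qed.

(** * Decomposition around the two largest letters *)

Lemma dumont_word_split_max_after (k : nat) (A B : seq nat) :
  ~~ odd k -> dumont_word k.+2 (A ++ [:: k.+1, k.+2 & B]) ->
  A = [::] /\ dumont_word k B \/
  exists j, [/\ k = j.+2, A != [::], B = [:: j.+2; j.+1] & dumont_word j A].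
Proof.
move=> ek /and3P[pw dw /avoids_patternsP aw].
have pw0 : perm_eq (A ++ B) (iota 1 k).
  apply/seq.permP => P; have /seq.permP/(_ P) := pw.
  by rewrite iota_add2 !count_cat /=; clear; lia.
have mAB x : (x \in A) || (x \in B) = (0 < x <= k).
  by rewrite -mem_cat (mem_perm_iota _ _ _ pw0).
have uAB : uniq (A ++ B) by rewrite (perm_uniq pw0) iota_uniq.
move: dw; rewrite dumont1_wordE last_cat /= => /andP[dw ow].
case: A => [|a A] in pw aw pw0 mAB uAB dw *.
  left; split=> //; apply/and3P; split=> //.
    rewrite dumont1_wordE; case: B dw ow {pw aw pw0 mAB uAB} => //= b B.
    by case/and3P=> _ _ -> ->.
  by apply/avoids_patternsP => x y z t sub; apply: aw; apply: subseq_trans sub _;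
    apply: (subseq_trans (subseq_cons _ _)); exact: subseq_cons.
right.
(* If y < x, then x, [k.+1], [k.+2], y is an occurrence of 2341. *)
have AltB x y : x \in a :: A -> y \in B -> x < y.
  move=> xA yB.
  have sub : subseq [:: x; k.+1; k.+2; y] ((a :: A) ++ [:: k.+1, k.+2 & B]).
    apply: (@cat_subseq _ [:: x] _ (a :: A)); first by rewrite sub1seq.
    by rewrite /= !eqxx sub1seq.
  have := aw _ _ _ _ sub; have := mAB x; have := mAB y.
  rewrite xA yB orbT /forbidden.
  have xy : x != y.
    apply/eqP => exy; move: uAB; rewrite cat_uniq => /and3P[_ /hasPn/(_ _ yB)].
    by rewrite -exy xA.
  by move: xy; clear; lia.
(* As a lies below B, an ascent x < y in B would make a, [k.+2], x, y an occurrence of 1423. *)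
have Bdec x y : subseq [:: x; y] B -> y <= x.
  move=> xyB; have sub : subseq [:: a; k.+2; x; y] ((a :: A) ++ [:: k.+1, k.+2 & B]).
    apply: (@cat_subseq _ [:: a] _ (a :: A)); first by rewrite sub1seq mem_head.
    apply: (@subseq_trans _ (k.+2 :: B)); last exact: subseq_cons.
    by rewrite /= eqxx.
  have xB : x \in B by apply: (mem_subseq xyB); rewrite mem_head.
  have yB : y \in B by apply: (mem_subseq xyB); rewrite !inE eqxx orbT.
  have := aw _ _ _ _ sub; have := AltB a x; have := mAB y.
  rewrite xB yB mem_head orbT /forbidden => h /(_ isT isT).
  by move: h; clear; lia.
have uB : uniq B by move: uAB; rewrite cat_uniq => /and3P[].
(* An empty B would leave the even letter [k.+2] last. *)
case: B => [|b1 B] in pw aw pw0 mAB uAB dw ow AltB Bdec uB *.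
  by move: ow => /=; rewrite (negPf ek).
have b1k : 0 < b1 <= k by rewrite -mAB mem_head orbT.
(* B lies above A, so it contains the largest remaining letter k; being decreasing, it starts with
   it. The same argument later gives the second letter. *)
have kB : k \in b1 :: B.
  have := mAB k; rewrite leqnn andbT; case: (boolP (k \in a :: A)) => [kA|_ /=].
    by have := AltB _ _ kA (mem_head _ _); move: b1k; clear; lia.
  by move=> ->; lia.
have eb1 : b1 = k.
  move: kB; rewrite inE => /orP[/eqP//|kB].
  by have := Bdec _ _ (subseq_head2 _ b1 _ _ kB); move: b1k; clear; lia.
subst b1.
case: k => [|k] in ek pw aw pw0 mAB dw ow AltB Bdec uAB uB b1k kB *; first by [].
case: k => [|j] in ek pw aw pw0 mAB dw ow AltB Bdec uAB uB b1k kB *; first by [].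
case: B => [|b2 B] in pw aw pw0 mAB uAB dw ow AltB Bdec uB kB *.
  by move: ow ek => /= ->.
have b2k : b2 < j.+2.
  have : b2 <= j.+2 by apply: Bdec; rewrite /= !eqxx sub0seq.
  by move: uB; rewrite /= inE negb_or => /andP[/andP[]]; clear; lia.
have eb2 : b2 = j.+1.
  have := mAB j.+1; rewrite /= ltnS leqnSn; case: (boolP (j.+1 \in a :: A)) => [jA _|_ /=].
    by have := AltB _ b2 jA; rewrite !inE eqxx orbT => /(_ isT); move: b2k; clear; lia.
  rewrite !inE => /orP[|/orP[/eqP-> //|]]; first by lia.
  move=> jB; have : j.+1 <= b2.
    by apply: Bdec; apply: (subseq_trans _ (subseq_cons _ _)); rewrite /= eqxx sub1seq.
  by move: b2k; clear; lia.
subst b2.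
(* A third letter would have to be larger than the odd letter [j.+1], yet B decreases. *)
case: B => [|b3 B] in pw aw pw0 mAB uAB dw ow AltB Bdec uB kB *; last first.
  have : b3 <= j.+1.
    by apply: Bdec; apply: (subseq_trans _ (subseq_cons _ _)); rewrite /= !eqxx sub0seq.
  move=> hb; exfalso; move: dw ek hb; rewrite /= cat_path /= /dumont_step /= !negbK.
  move=> h /negPf ej; move: h; rewrite ej /= => /and5P[_ _ _ _].
  by case/and3P=> _ lt3 _; rewrite leqNgt lt3.
exists j; split=> //; apply/and3P; split.
- apply/seq.permP => P; have /seq.permP/(_ P) := pw0.
  by rewrite iota_add2 !count_cat /=; clear; lia.
(* The last letter of A is followed by the larger [j.+3], hence it is odd. *)
- move: dw ek; rewrite dumont1_wordE /= cat_path /= /dumont_step /= => /andP[-> ].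
  have : last a A <= j.+2 
    by have := mAB (last a A); rewrite mem_last => /esym/andP[].
  move=> la /andP[+ _] _; case: ifP => // _ lt; move: la lt; clear; lia.
- apply/avoids_patternsP => x y z t sub; apply: aw; apply: subseq_trans sub _.
  exact: prefix_subseq.
Qed.

Lemma dumont_word_split_max_before (k : nat) (A B : seq nat) :
  0 < k -> ~~ odd k -> dumont_word k.+2 (A ++ k.+2 :: rcons B k.+1) ->
  A = [::] /\ dumont_word k B \/ B = [::] /\ dumont_word k A \/
  exists j, [/\ k = j.+2, B != [::], A = [:: j.+2; j.+1] & dumont_word j B].
Proof.
move=> k0 ek /and3P[pw dw /avoids_patternsP aw].
have pw0 : perm_eq (A ++ B) (iota 1 k).
  apply/seq.permP => P; have /seq.permP/(_ P) := pw.
  by rewrite iota_add2 !count_cat /= -cats1 count_cat /=; clear; lia.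
have mAB x : (x \in A) || (x \in B) = (0 < x <= k).
  by rewrite -mem_cat (mem_perm_iota _ _ _ pw0).
have uAB : uniq (A ++ B) by rewrite (perm_uniq pw0) iota_uniq.
(* The last letter of B is followed by the larger [k.+1], hence it is odd. *)
have dB : B != [::] -> dumont1_word B.
  rewrite dumont1_wordE last_cat /= last_rcons in dw.
  case: B dw mAB {pw aw pw0 uAB} => //= b B; rewrite dumont1_wordE /=.
  case: A => [|a A] dw mAB _.
    move: dw => /=; rewrite rcons_path ek andbT => /and3P[_ -> /=].
    have : last b B <= k.
      by have := mAB (last b B); rewrite mem_last orbT => /esym/andP[].
    rewrite /dumont_step; case: ifP => // _; clear; lia.
  move: dw; rewrite /= cat_path /= rcons_path => /andP[/and4P[_ _ _ /andP[-> +]] _].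
  have : last b B <= k.
    by have := mAB (last b B); rewrite mem_last orbT => /esym/andP[].
  rewrite /dumont_step; case: ifP => // _; clear; lia.
have aB : all (avoids_pattern B) dumont_patterns.
  apply/avoids_patternsP => x y z t sub; apply: aw; apply: subseq_trans sub _.
  by rewrite -cats1 -cat_rcons catA; apply: subseq_trans (prefix_subseq _ _); apply: suffix_subseq.
have [eA|A0] := eqVneq A [::].
  left; split=> //; apply/and3P; split=> //; first by rewrite eA in pw0.
  apply: dB; apply/eqP => eB; by have := mAB k; rewrite eA eB leqnn k0 !in_nil.
right; have [eB|B0] := eqVneq B [::].
  left; split=> //; apply/and3P; split; first by rewrite eB cats0 in pw0.
    rewrite eB dumont1_wordE last_cat /= in dw.
    case: A A0 dw mAB {pw aw pw0 uAB aB} => // a A _ + mAB.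
    rewrite dumont1_wordE /= cat_path /= => /andP[/and3P[-> + _] _].
    have : last a A <= k.
      by have := mAB (last a A); rewrite mem_last => /esym/andP[].
    by rewrite /dumont_step; case: ifP => // _; clear; lia.
  apply/avoids_patternsP => x y z t sub; apply: aw; apply: subseq_trans sub _.
  exact: prefix_subseq.
right.
(* If x < y, then x, [k.+2], y, [k.+1] is an occurrence of 1423. *)
have AgtB x y : x \in A -> y \in B -> y < x.
  move=> xA yB.
  have sub : subseq [:: x; k.+2; y; k.+1] (A ++ k.+2 :: rcons B k.+1).
    apply: (@cat_subseq _ [:: x] _ A); first by rewrite sub1seq.
    rewrite /= eqxx -cats1; apply: (@cat_subseq _ [:: y]); rewrite sub1seq ?inE //.
  have := aw _ _ _ _ sub; have := mAB y; rewrite yB orbT /forbidden.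
  have xy : x != y.
    apply/eqP => exy; move: uAB; rewrite cat_uniq => /and3P[_ /hasPn/(_ _ yB)].
    by rewrite -exy xA.
  by move: xy; clear; lia.
have [b bB] : exists b, b \in B.
  by case: (B) B0 => // b B' _; exists b; rewrite mem_head.
(* As b lies below A, an ascent x < y in A would make x, y, [k.+2], b an occurrence of 2341. *)
have Adec x y : subseq [:: x; y] A -> y <= x.
  move=> xyA; have sub : subseq [:: x; y; k.+2; b] (A ++ k.+2 :: rcons B k.+1).
    apply: (@cat_subseq _ [:: x; y]) => //.
    by rewrite /= eqxx sub1seq mem_rcons inE bB orbT.
  have xA : x \in A by apply: (mem_subseq xyA); rewrite mem_head.
  have yA : y \in A by apply: (mem_subseq xyA); rewrite !inE eqxx orbT.
  have := aw _ _ _ _ sub; have := AgtB x b; have := mAB y.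
  rewrite xA yA bB /forbidden => h /(_ isT isT).
  by move: h; clear; lia.
have uA : uniq A by move: uAB; rewrite cat_uniq => /and3P[].
have bk : 0 < b <= k by rewrite -mAB bB orbT.
case: A A0 => [|a1 A] // _ in pw aw pw0 mAB uAB dw AgtB Adec uA *.
have a1k : 0 < a1 <= k by rewrite -mAB mem_head.
have ea1 : a1 = k.
  have := mAB k; rewrite leqnn andbT k0 => /orP[|kB].
    rewrite inE => /orP[/eqP//|kA].
    by have := Adec _ _ (subseq_head2 _ a1 _ _ kA); move: a1k; clear; lia.
  by have := AgtB _ _ (mem_head _ _) kB; move: a1k; clear; lia.
subst a1.
(* A cannot be k alone: k is even and would be followed by the larger [k.+2]. *)
case: A => [|a2 A] in pw aw pw0 mAB uAB dw AgtB Adec uA *.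
  by move: dw; rewrite dumont1_wordE /= /dumont_step (negPf ek); clear; lia.
have a2k : a2 < k.
  have : a2 <= k by apply: Adec; rewrite /= !eqxx sub0seq.
  by move: uA; rewrite /= inE negb_or => /andP[/andP[]]; clear; lia.
case: k => [|k] in k0 ek pw aw pw0 mAB dw AgtB Adec uAB uA bk a1k a2k *; first by [].
case: k => [|j] in k0 ek pw aw pw0 mAB dw AgtB Adec uAB uA bk a1k a2k *; first by [].
have ea2 : a2 = j.+1.
  have := mAB j.+1; rewrite ltnS leqnSn => /orP[|jB].
    rewrite !inE => /orP[|/orP[/eqP-> //|jA]]; first by clear; lia.
    have : j.+1 <= a2.
      by apply: Adec; apply: (subseq_trans _ (subseq_cons _ _)); rewrite /= eqxx sub1seq.
    by move: a2k; clear; lia.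
  by have := AgtB a2 _ _ jB; rewrite !inE eqxx orbT => /(_ isT); move: a2k; clear; lia.
subst a2.
have ej : odd j = false by move: ek; rewrite /= negbK => /negPf.
(* The odd letter [j.+1] must be followed by a larger one, so A, being decreasing, stops there. *)
case: A => [|a3 A] in pw aw pw0 mAB uAB dw AgtB Adec uA *; last first.
  have : a3 <= j.+1.
    by apply: Adec; apply: (subseq_trans _ (subseq_cons _ _)); rewrite /= !eqxx sub0seq.
  move: dw; rewrite dumont1_wordE /= /dumont_step /= ej /= => /andP[/and3P[_ lt3 _] _].
  by rewrite leqNgt lt3.
exists j; split=> //; apply/and3P; split=> //; last exact: dB.
apply/seq.permP => P; have /seq.permP/(_ P) := pw0.
by rewrite iota_add2 !count_cat /=; clear; lia.
Qed.

Lemma dumont_word_split (k : nat) (w : seq nat) :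
  0 < k -> ~~ odd k -> dumont_word k.+2 w ->
  (exists p w0, [/\ p \in wraps2 k, dumont_word k w0 & w = p.1 ++ w0 ++ p.2]) \/
  (exists j p w0, [/\ k = j.+2, p \in wraps4 j, w0 != [::],
                      dumont_word j w0 & w = p.1 ++ w0 ++ p.2]).
Proof.
move=> k0 ek dw; have /and3P[pw sw _] := dw.
have k1w : k.+1 \in w by rewrite (mem_perm_iota _ _ _ pw) /=.
case/splitPr: k1w => A B in dw pw sw *.
case: B => [|y B] in dw pw sw *.
  have k2A : k.+2 \in A.
    have := mem_perm_iota _ k.+2 _ pw; rewrite leqnn mem_cat inE.
    by rewrite -[k.+2 == _]/(k.+1 == k) gtn_eqF // orbF.
  case/splitPr: k2A => A1 B1 in dw pw sw *.
  have e : (A1 ++ k.+2 :: B1) ++ [:: k.+1] = A1 ++ k.+2 :: rcons B1 k.+1.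
    by rewrite -catA cat_cons cats1.
  rewrite e in dw *.
  case: (dumont_word_split_max_before k _ _ k0 ek dw) => [[-> dB]|[[-> dA]|[j [kj B0 -> dB]]]].
  - left; exists ([:: k.+2], [:: k.+1]), B1; split=> //; last by rewrite /= cats1.
    by rewrite !inE eqxx orbT.
  - left; exists ([::], [:: k.+2; k.+1]), A1; split=> //.
    by rewrite !inE eqxx !orbT.
  right; exists j, ([:: j.+2; j.+1; j.+4], [:: j.+3]), B1; split=> //.
    by rewrite !inE eqxx !orbT.
  by rewrite kj /= cats1.
(* The letter [k.+1] is odd, so its successor is larger, and only [k.+2] is. *)
have ey : y = k.+2.
  have yk : y <= k.+2.
    by have := mem_perm_iota _ y _ pw; rewrite mem_cat !inE eqxx !orbT => /esym/andP[].
  move: sw; rewrite dumont1_wordE => /andP[+ _].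
  case: A {dw pw} => [|a A] /=; rewrite ?cat_path /= /dumont_step /= ek;
    [case/andP=> + _ | case/and4P=> _ _ + _]; move: yk; clear; lia.
subst y.
case: (dumont_word_split_max_after k _ _ ek dw) => [[-> dB]|[j [kj A0 -> dA]]].
  left; exists ([:: k.+1; k.+2], [::]), B; split=> //; last by rewrite /= cats0.
  by rewrite !inE eqxx.
right; exists j, ([::], [:: j.+3; j.+4; j.+2; j.+1]), A; split=> //.
  by rewrite !inE eqxx.
by rewrite kj.
Qed.

(** * Recursive list of the class, complete and without repetition *)

Lemma dumont_word2 (w : seq nat) : dumont_word 2 w = (w == [:: 2; 1]).
Proof.
apply/idP/eqP => [/and3P[pw dw _]|->].
  have sz := perm_size pw.
  case: w sz pw dw => [|x [|y []]] //= _ pw.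
  have := mem_perm_iota 2 x _ pw; have := mem_perm_iota 2 y _ pw.
  rewrite !inE !eqxx orbT /= => hy hx.
  rewrite dumont1_wordE /= /dumont_step.
  by case: x hx pw => [|[|[|x]]] //=; case: y hy => [|[|[|y]]].
apply/and3P; split=> //; apply/avoids_patternsP => a b c d /size_subseq.
by [].
Qed.

(* Rank 0 is left empty although the empty word qualifies: wrapping the empty word at rank 2 would
   only repeat words that already come from rank 1. *)
Fixpoint dumont_list (n : nat) : seq (seq nat) :=
  if n is n'.+1 then
    if n' is m.+1 then
      [seq p.1 ++ w ++ p.2 | p <- wraps2 n'.*2, w <- dumont_list n'] ++
      [seq p.1 ++ w ++ p.2 | p <- wraps4 m.*2, w <- dumont_list m]
    else [:: [:: 2; 1]]
  else [::].

Arguments dumont_list : simpl never.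

Lemma dumont_listSS (m : nat) :
  dumont_list m.+2 =
    [seq p.1 ++ w ++ p.2 | p <- wraps2 m.+1.*2, w <- dumont_list m.+1] ++
    [seq p.1 ++ w ++ p.2 | p <- wraps4 m.*2, w <- dumont_list m].
Proof. by []. Qed.

Lemma nat_ind2 (P : nat -> Prop) :
  P 0 -> P 1 -> (forall n, P n -> P n.+1 -> P n.+2) -> forall n, P n.
Proof.
move=> P0 P1 PS n; suff [] : P n /\ P n.+1 by [].
by elim: n => [|n [IH1 IH2]]; split=> //; apply: PS.
Qed.

Lemma dumont_word_neq0 (k : nat) (w : seq nat) :
  0 < k -> dumont_word k w -> w != [::].
Proof. by case: k => // k _ /and3P[/perm_size]; case: w. Qed.

Lemma mem_dumont_list (n : nat) (w : seq nat) :
  (w \in dumont_list n) = (0 < n) && dumont_word n.*2 w.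
Proof.
elim/nat_ind2: n w => [|| m IH0 IH1] w //; first by rewrite dumont_word2 inE.
rewrite dumont_listSS mem_cat; apply/orP/idP => [[]/allpairsP[[p w0] /=]|].
- rewrite IH1 => -[hp /andP[_ dw] ->].
  have w0N := dumont_word_neq0 m.+1.*2 _ isT dw.
  have ek : ~~ odd m.+1.*2 by rewrite odd_double.
  have := dumont_word_wrap _ p.1 _ p.2 ek w0N dw.
  rewrite -surjective_pairing mem_cat hp => /(_ isT).
  suff -> : m.+1.*2 + size p.1 + size p.2 = m.+2.*2 by [].
  by move: hp; rewrite !inE => /or3P[] /eqP-> /=; lia.
- rewrite IH0 => -[hp /andP[m0 dw] ->].
  have m20 : 0 < m.*2 by rewrite double_gt0.
  have w0N := dumont_word_neq0 _ _ m20 dw.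
  have ek : ~~ odd m.*2 by rewrite odd_double.
  have := dumont_word_wrap _ p.1 _ p.2 ek w0N dw.
  rewrite -surjective_pairing mem_cat hp orbT => /(_ isT).
  suff -> : m.*2 + size p.1 + size p.2 = m.+2.*2 by [].
  by move: hp; rewrite !inE => /orP[] /eqP-> /=; lia.
move=> /andP[_ dw]; have ek : ~~ odd m.+1.*2 by rewrite odd_double.
case: (dumont_word_split m.+1.*2 w isT ek dw) => [[p [w0 [hp dw0 ->]]]|].
  by left; apply/allpairsP; exists (p, w0); rewrite /= IH1.
case=> j [p [w0 [[<-] hp w0N dw0 ->]]].
right; apply/allpairsP; exists (p, w0); split=> //=; rewrite IH0 dw0 andbT.
(* At [m] = 0 the inner word would be empty, which [w0N] excludes; this matches the empty list at
   rank 0. *)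
case: (m) dw0 => // /and3P[pw _ _]; move: w0N.
by rewrite -size_eq0 (perm_size pw).
Qed.

(** Letters of [w] and [w'] are at most [k] and all added letters exceed it, so the first and last
    letters of the extended word identify the pair. The inner words then have equal length and
    cancellation applies. *)
Lemma wrap_inj (k : nat) (p q : seq nat * seq nat) (w w' : seq nat) :
  w != [::] -> w' != [::] ->
  all (fun x => x <= k) w -> all (fun x => x <= k) w' ->
  (p \in wraps2 k) && (q \in wraps2 k) || (p \in wraps4 k) && (q \in wraps4 k) ->
  p.1 ++ w ++ p.2 = q.1 ++ w' ++ q.2 -> (p, w) = (q, w').
Proof.
case: w w' => [|x w] [|x' w'] // _ _ bw bw' hpq e.
have xk : x <= k := allP bw x (mem_head _ _).
have x'k : x' <= k := allP bw' x' (mem_head _ _).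
have lk : last x w <= k := allP bw _ (mem_last _ _).
have l'k : last x' w' <= k := allP bw' _ (mem_last _ _).
have := congr1 (head 0) e; have := congr1 (last 0) e.
suff epq : head 0 (p.1 ++ (x :: w) ++ p.2) = head 0 (q.1 ++ (x' :: w') ++ q.2) ->
    last 0 (p.1 ++ (x :: w) ++ p.2) = last 0 (q.1 ++ (x' :: w') ++ q.2) -> p = q.
  move=> /epq h /h epq'; subst q; congr pair.
  have sz : size (x :: w) = size (x' :: w').
    by have /eqP := congr1 size e; rewrite !size_cat eqn_add2l eqn_add2r => /eqP.
  by move/eqP: e; rewrite eqseq_cat // eqxx /= -!cat_cons eqseq_cat // => /andP[/eqP].
move: hpq {e bw bw'}; rewrite !inE.
by case/orP=> /andP[hp hq]; do ?[case/orP: hp => hp]; do ?[case/orP: hq => hq];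
   rewrite (eqP hp) (eqP hq) //= ?last_cat /=; lia.
Qed.

Lemma wraps2_neq_wraps4 (k : nat) (p q : seq nat * seq nat) (w w' : seq nat) :
  w != [::] -> w' != [::] ->
  all (fun x => x <= k.+2) w -> all (fun x => x <= k) w' ->
  p \in wraps2 k.+2 -> q \in wraps4 k -> p.1 ++ w ++ p.2 <> q.1 ++ w' ++ q.2.
Proof.
case: w w' => [|x w] [|x' w'] // _ _ bw bw' hp hq e.
have xk : x <= k.+2 := allP bw x (mem_head _ _).
have x'k : x' <= k := allP bw' x' (mem_head _ _).
have lk : last x w <= k.+2 := allP bw _ (mem_last _ _).
have l'k : last x' w' <= k := allP bw' _ (mem_last _ _).
have := congr1 (head 0) e; have := congr1 (last 0) e.
(* The next-to-last letter separates w N (N-1) from (N-2)(N-3) N w' (N-1), which may agree at both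
   ends: it is N in one and a letter of [w'] in the other. *)
have := congr1 (fun s => last 0 (belast 0 s)) e.
move: hp hq {e bw bw'}; rewrite !inE => hp hq.
by do ?[case/orP: hp => hp]; do ?[case/orP: hq => hq];
   rewrite (eqP hp) (eqP hq) //= ?belast_cat ?last_cat /= ?last_cat /=; lia.
Qed.

Lemma dumont_list_bound (n : nat) (w : seq nat) :
  w \in dumont_list n -> w != [::] /\ all (fun x => x <= n.*2) w.
Proof.
rewrite mem_dumont_list => /andP[n0 dw].
split; first by apply: dumont_word_neq0 dw; rewrite double_gt0.
case/and3P: dw => pw _ _; apply/allP => x.
by rewrite (mem_perm_iota _ _ _ pw) => /andP[].
Qed.

Lemma dumont_list_uniq (n : nat) : uniq (dumont_list n).
Proof.
elim/nat_ind2: n => [|| m u0 u1] //; rewrite dumont_listSS cat_uniq.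
apply/and3P; split.
- apply: allpairs_uniq => //.
    by rewrite /= !inE !xpair_eqE /= !eqseq_cons; lia.
  move=> _ _ /allpairsP[[p w] [hp hw ->]] /allpairsP[[q w'] [hq hw' ->]].
  rewrite /= in hp hw hq hw' *.
  have [w0 bw] := dumont_list_bound _ _ hw.
  have [w0' bw'] := dumont_list_bound _ _ hw'.
  by apply: (wrap_inj m.+1.*2) => //; rewrite hp hq.
- apply/hasPn => v /allpairsP[[q w'] [hq hw' ->]].
  apply/negP => /allpairsP[[p w] [hp hw]] /esym.
  rewrite /= in hp hw hq hw' *.
  have [w0 bw] := dumont_list_bound _ _ hw.
  have [w0' bw'] := dumont_list_bound _ _ hw'.
  exact: (wraps2_neq_wraps4 m.*2).
apply: allpairs_uniq => //.
move=> _ _ /allpairsP[[p w] [hp hw ->]] /allpairsP[[q w'] [hq hw' ->]].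
  rewrite /= in hp hw hq hw' *.
have [w0 bw] := dumont_list_bound _ _ hw.
have [w0' bw'] := dumont_list_bound _ _ hw'.
by apply: (wrap_inj m.*2) => //; rewrite hp hq orbT.
Qed.

Lemma size_dumont_listSS (m : nat) :
  size (dumont_list m.+2) =
  3 * size (dumont_list m.+1) + 2 * size (dumont_list m).
Proof. by rewrite dumont_listSS size_cat !size_allpairs. Qed.

(** * From words back to permutations *)

Lemma nth_perm_word (m : nat) (s : 'S_m) (i : 'I_m) :
  nth 0 (perm_word s) i = (s i).+1.
Proof.
by rewrite /perm_word (nth_map i) ?size_enum_ord // nth_ord_enum.
Qed.

Lemma perm_word_inj (m : nat) : injective (@perm_word m).
Proof.
move=> s t e; apply/permP => i; apply/val_inj/succn_inj.
by rewrite -!nth_perm_word e.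
Qed.

Lemma perm_word_iota (m : nat) (s : 'S_m) : perm_eq (perm_word s) (iota 1 m).
Proof.
apply: uniq_perm; last 1 first.
- move=> x; rewrite mem_iota add1n ltnS; apply/mapP/andP => [[i _ ->]|[x0 xm]].
    by split=> //; exact: ltn_ord.
  have xm' : x.-1 < m by rewrite prednK.
  exists (s^-1%g (Ordinal xm')); first by rewrite mem_enum.
  by rewrite permKV /= prednK.
- by rewrite map_inj_uniq ?enum_uniq // => i j [] /val_inj/perm_inj.
exact: iota_uniq.
Qed.

Lemma perm_word_surj (m : nat) (w : seq nat) :
  perm_eq w (iota 1 m) -> exists s : 'S_m, perm_word s = w.
Proof.
move=> pw; have sz : size w = m by rewrite (perm_size pw) size_iota.
have bnd (i : 'I_m) : 0 < nth 0 w i <= m.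
  by rewrite -(mem_perm_iota _ _ _ pw) mem_nth ?sz.
have lt_m (i : 'I_m) : (nth 0 w i).-1 < m.
  by have /andP[h1 h2] := bnd i; rewrite prednK.
have inj : injective (fun i => Ordinal (lt_m i)).
  move=> i j [] /(congr1 succn).
  have /andP[hi _] := bnd i; have /andP[hj _] := bnd j.
  rewrite !prednK // => /eqP; rewrite nth_uniq ?sz //.
    by move/eqP/val_inj.
  by rewrite (perm_uniq pw) iota_uniq.
exists (perm inj); apply: (@eq_from_nth _ 0) => [|i].
  by rewrite size_map size_enum_ord sz.
rewrite size_map size_enum_ord => im.
rewrite -[i]/(val (Ordinal im)) nth_perm_word permE /= prednK //.
by have /andP[] := bnd (Ordinal im).
Qed.

Lemma card_Dumont1_avoiding (n : nat) :
  0 < n -> #|Dumont1_avoiding n dumont_patterns| = size (dumont_list n).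
Proof.
move=> n0; rewrite cardE -(size_map (@perm_word _)); apply: perm_size.
apply: uniq_perm; first by rewrite map_inj_uniq ?enum_uniq //; apply: perm_word_inj.
  exact: dumont_list_uniq.
move=> w; rewrite mem_dumont_list n0 /=; apply/mapP/idP => [[s]|dw].
  by rewrite mem_enum inE => /andP[d a] ->; rewrite /dumont_word perm_word_iota d.
have /and3P[pw d a] := dw; have [s es] := perm_word_surj _ _ pw.
by exists s => //; rewrite mem_enum inE es d.
Qed.

(** * Closed form and nearest integer *)

Local Open Scope ring_scope.

(** Both sides obey the same second-order recurrence with initial values 0 and 1; the empty list at
    rank 0 makes the formula valid from [n] = 0. *)
Lemma size_dumont_list_closed (R : realType) (n : nat) :
  let s17 : R := Num.sqrt 17 in
  (size (dumont_list n))%:R =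
  s17^-1 * (((3 + s17) / 2) ^+ n - ((3 - s17) / 2) ^+ n).
Proof.
move=> s; have s2 : s ^+ 2 = 17 by rewrite sqr_sqrtr.
have s0 : s != 0 by rewrite sqrtr_eq0 -ltNge.
elim/nat_ind2: n => [|| n IH0 IH1].
- by rewrite !expr0 subrr mulr0.
- by rewrite !expr1 /=; field.
rewrite size_dumont_listSS natrD !natrM IH0 IH1.
(* Powers of a root of x^2 = 3x + 2 satisfy the recurrence of the list sizes. *)
have rt (x : R) : x * x = 3 * x + 2 -> x ^+ n.+2 = 3 * x ^+ n.+1 + 2 * x ^+ n.
  by move=> h; rewrite !exprS mulrA h; ring.
rewrite (rt ((3 + s) / 2)); last by move: s2; lra.
rewrite (rt ((3 - s) / 2)); last by move: s2; lra.
by ring.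
Qed.

Theorem theorem3p7 (R : realType) (n : nat) (hn : (1 <= n)%N) :
  let c := #|Dumont1_avoiding n [:: [:: 2; 3; 4; 1]; [:: 1; 4; 2; 3]]%N| in
  let s17 : R := Num.sqrt 17 in
  (c%:R = s17^-1 * (((3 + s17) / 2) ^+ n - ((3 - s17) / 2) ^+ n))
  /\ (c%:Z = nearest_int (s17^-1 * ((3 + s17) / 2) ^+ n)).
Proof.
move=> c s17.
have cE : c%:R = s17^-1 * (((3 + s17) / 2) ^+ n - ((3 - s17) / 2) ^+ n).
  by rewrite /c card_Dumont1_avoiding // size_dumont_list_closed.
(* It suffices that [c] and the first term differ by less than 1/2; their difference is the term of
   the second root. *)
split=> //; apply/esym/floor_def.
(* The bounds 4 and 5 place (3 - [s17])/2 between -1 and -1/2, so its powers stay within 1 in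
   absolute value, and they make the inverse of [s17] less than 1/2. *)
have s4 : 4 < s17 by rewrite -(ltr_pXn2r (n := 2)) ?nnegrE // ?sqrtr_ge0 // sqr_sqrtr //; lra.
have s5 : s17 < 5.
  by rewrite -(ltr_pXn2r (n := 2)) ?nnegrE // ?sqrtr_ge0 // sqr_sqrtr //; lra.
have err : `|s17^-1 * ((3 - s17) / 2) ^+ n| < 1 / 2.
  rewrite normrM normrX normfV (gtr0_norm (x := s17)); last by lra.
  have le1 : `|(3 - s17) / 2| <= 1 by rewrite ler_norml; lra.
  have le1n := exprn_ile1 n (normr_ge0 _) le1.
  apply: (@le_lt_trans _ _ s17^-1).
    by rewrite ler_piMr // invr_ge0; lra.
  by rewrite -[_ / _]invf_div divr1 ltf_pV2 ?posrE; lra.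
have := err; rewrite ltr_norml => /andP[lo hi].
rewrite intrD -pmulrn cE mulrBr; apply/andP; split; lra.
Qed.
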